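(* Let $(G,u)$ be a partially ordered abelian group with order unit $u$, let $H$ be a subgroup of $G$, let $Z_G(H)=\{\tau\in S(G,u)\mid \tau(h)=0 \text{ for all } h\in H\}$, and let $F$ be the smallest face of $S(G,u)$ containing $Z_G(H)$. Suppose that $H$ has property (B). Then for every $\tau\in F$, either $\tau(H)=\{0\}$ or $\tau(H)$ is dense in $\mathbb{R}$.
   Context: A partially ordered abelian group is an abelian group $G$ with a translation-invariant partial order; $G^+=\{x\ge 0\}$. An order unit is a nonzero $u\in G^+$ such that for each $g\in G$ there is a positive integer $N$ with $-Nu\le g\le Nu$. A trace on $G$ is a nonzero group homomorphism $\tau:G\to\mathbb{R}$ with $\tau(G^+)\subseteq[0,\infty)$; $S(G,u)$ is the set of traces with $\tau(u)=1$, a compact convex subset of $\mathbb{R}^G$ (product topology). A face of a convex set $K$ is a subset $F\subseteq K$ such that any line segment in $K$ whose relative interior meets $F$ is contained in $F$. For a subgroup $H$ of $G$ and an integer $m>1$, $H$ satisfies $(B_m)$ if for every $h\in H$ and every $\epsilon>0$ there exists $h'\in H$ with $\tau(h)-m\tau(h')\ge-\epsilon$ for all $\tau\in S(G,u)$; $H$ has property (B) if it satisfies $(B_m)$ for some integer $m>1$. *)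

(* Defs.v *)
From HB Require Import structures.
From mathcomp Require Import all_boot all_order all_algebra.
From mathcomp Require Import all_classical all_reals all_analysis.

Set Implicit Arguments.
Unset Strict Implicit.
Unset Printing Implicit Defensive.

Import Order.TTheory GRing.Theory Num.Theory.
Import numFieldNormedType.Exports.

Local Open Scope classical_set_scope.
Local Open Scope ring_scope.

(* [porderZmodType] only joins a partial order and an abelian group, with no
   compatibility between them. *)
Definition translation_invariant (G : porderZmodType) : Prop :=
  forall x y z : G, x <= y -> x + z <= y + z.

Definition order_unit (G : porderZmodType) (u : G) : Prop :=
  [/\ u != 0, 0 <= u &
      forall g : G, exists N : nat,
        [/\ (0 < N)%N, - (u *+ N) <= g & g <= u *+ N]].

Definition trace (R : realType) (G : porderZmodType) (tau : G -> R) : Prop :=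
  [/\ zmod_morphism tau,
      exists g : G, tau g != 0 &
      forall g : G, 0 <= g -> 0 <= tau g].

Definition trace_space (R : realType) (G : porderZmodType) (u : G) :
    set (G -> R) :=
  [set tau | trace tau /\ tau u = 1].

Definition segment (R : realType) (V : lmodType R) (x y : V) : set V :=
  [set (1 - t) *: x + t *: y | t in `[0, 1]].

(* The relative interior of [segment x y]; for [x = y] it is the point [x]. *)
Definition open_segment (R : realType) (V : lmodType R) (x y : V) : set V :=
  [set (1 - t) *: x + t *: y | t in `]0, 1[].

Definition face (R : realType) (V : lmodType R) (K F : set V) : Prop :=
  F `<=` K /\
  forall x y : V, segment x y `<=` K ->
    open_segment x y `&` F !=set0 -> segment x y `<=` F.

Definition vanishing_traces (R : realType) (G : porderZmodType) (u : G)
    (H : zmodClosed G) : set (G -> R) :=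
  [set tau | trace_space u tau /\ forall h : G, h \in H -> tau h = 0].

Definition property_Bm (R : realType) (G : porderZmodType) (u : G)
    (H : zmodClosed G) (m : nat) : Prop :=
  forall h : G, h \in H -> forall eps : R, 0 < eps ->
    exists2 h' : G, h' \in H &
      forall tau : G -> R, trace_space u tau ->
        - eps <= tau h - m%:R * tau h'.

Definition property_B (R : realType) (G : porderZmodType) (u : G)
    (H : zmodClosed G) : Prop :=
  exists2 m : nat, (1 < m)%N & property_Bm R u H m.

(* Main.v *)
(** If [tau] lies in the face generated by the traces vanishing on [H], then
    [c tau <= sigma] on the positive cone for some [c > 0] and some trace
    [sigma] vanishing on [H], since the traces dominated in this way form a
    face.  Hence [sigma - c tau] is a positive multiple of a trace, and applying
    property (B) to it bounds [tau h - m tau h'] from above, while applying it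
    to [tau] bounds the same quantity from below.  So every element of the
    subgroup [tau(H)] of the reals is a limit of elements of [m tau(H)], which
    forces arbitrarily small nonzero elements unless [tau(H) = 0]. *)
Require Import Defs.
From HB Require Import structures.
From mathcomp Require Import all_boot all_order all_algebra.
From mathcomp Require Import all_classical all_reals all_analysis.
From mathcomp Require Import ring lra.

Set Implicit Arguments.
Unset Strict Implicit.
Unset Printing Implicit Defensive.

Import Order.TTheory GRing.Theory Num.Theory.
Import numFieldNormedType.Exports.

Local Open Scope classical_set_scope.
Local Open Scope ring_scope.

Definition dominated_traces (R : realType) (G : porderZmodType) (u : G)
    (Z : set (G -> R)) : set (G -> R) :=
  [set tau | trace_space u tau /\
    exists c : R, exists sigma : G -> R,
      [/\ 0 < c, Z sigma & forall g : G, 0 <= g -> c * tau g <= sigma g]].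

(** If [p = (1 - t) x + t y] is dominated with constant [c], each [z] on the segment is dominated
    with constant [c t (1 - t)]: the coefficients of [z] are at most 1, so [t (1 - t) z <= p] on the
    positive cone. *)
Lemma dominated_traces_face (R : realType) (G : porderZmodType) (u : G)
    (Z : set (G -> R)) : face (trace_space u) (dominated_traces u Z).
Proof.
split=> [tau []//|x y xyS [p [[t /= t01 <-] [_ [c [sigma [c0 Zsigma le_c]]]]]]].
move=> z xyz; split; first exact: xyS.
have [s /= s01 <-] := xyz.
have xS : trace_space u x.
  by apply: xyS; exists 0; rewrite /= ?in_itv/= ?lexx ?ler01// subr0 scale1r
    scale0r addr0.
have yS : trace_space u y.
  by apply: xyS; exists 1; rewrite /= ?in_itv/= ?lexx ?ler01// subrr scale1r
    scale0r add0r.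
move: t01 s01; rewrite !in_itv/= => /andP[t0 t1] /andP[s0 s1].
exists (c * (t * (1 - t))), sigma; split=> // [|g g0].
  by rewrite !mulr_gt0// subr_gt0.
apply: le_trans (le_c g g0).
have [[[_ _ /(_ g g0) xg0] _] [[_ _ /(_ g g0) yg0] _]] := (xS, yS).
rewrite -mulrA ler_pM2l//.
change (t * (1 - t) * ((1 - s) * x g + s * y g) <= (1 - t) * x g + t * y g).
(* [hx] and [hy] are the differences of the [x g] and [y g] terms of the two sides, factored. *)
have hx : 0 <= (1 - t) * (1 - t * (1 - s)) * x g.
  by rewrite !mulr_ge0//; nra.
have hy : 0 <= t * (1 - (1 - t) * s) * y g by rewrite !mulr_ge0//; nra.
nra.
Qed.

Lemma subset_dominated_traces (R : realType) (G : porderZmodType) (u : G)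
    (Z : set (G -> R)) :
  Z `<=` trace_space u -> Z `<=` dominated_traces u Z.
Proof.
move=> ZS tau Ztau; split; first exact: ZS.
by exists 1, tau; split=> // g _; rewrite mul1r.
Qed.

(** This is the complementary trace [rho] with [sigma = c tau + (1 - c) rho]; the factor normalises
    [sigma - c tau], whose value at [u] is [1 - c]. *)
Lemma trace_space_diff (R : realType) (G : porderZmodType) (u : G) (c : R)
    (sigma tau : G -> R) :
  trace_space u sigma -> trace_space u tau -> c < 1 ->
  (forall g, 0 <= g -> c * tau g <= sigma g) ->
  trace_space u (fun g => (1 - c)^-1 * (sigma g - c * tau g)).
Proof.
move=> [[sB _ _] su] [[tB _ _] tu] c1 le_c.
have c1' : 0 < 1 - c by rewrite subr_gt0.
have uE : (1 - c)^-1 * (sigma u - c * tau u) = 1.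
  by rewrite su tu mulr1 mulVf// gt_eqF.
split=> //; split=> [x y||g g0].
- by rewrite sB tB; ring.
- by exists u; rewrite uE oner_neq0.
- by rewrite mulr_ge0 ?invr_ge0 ?(ltW c1')// subr_ge0 le_c.
Qed.

Lemma dominated_trace_approx (R : realType) (G : porderZmodType) (u : G)
    (H : zmodClosed G) (m : nat) (tau : G -> R) :
  0 <= u -> property_Bm R u H m ->
  dominated_traces u (vanishing_traces u H) tau ->
  forall h, h \in H -> forall eps, 0 < eps ->
    exists2 h', h' \in H & `|tau h - m%:R * tau h'| <= eps.
Proof.
move=> u_ge0 Bm [tauS [c0 [sigma [c00 [sigmaS sigma0] le_c0]]]] h Hh eps eps0.
have [[_ _ tau_ge0] tauu] := tauS.
(* Halving the constant makes it smaller than 1, so that the difference below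
   does not vanish at [u]. *)
pose c := c0 / 2; have c_gt0 : 0 < c by rewrite divr_gt0.
have le_c g : 0 <= g -> c * tau g <= sigma g.
  by move=> g0; have := le_c0 g g0; have := tau_ge0 g g0; rewrite /c; nra.
have c0_le1 : c0 <= 1 by have := le_c0 u u_ge0; rewrite tauu mulr1 sigmaS.2.
have c1 : c < 1 by rewrite /c; lra.
(* On [H] the complementary trace equals [- c / (1 - c) * tau]. Tolerance [c eps] thus gives the
   upper bound [(1 - c) eps] and the lower bound [- c eps], both within [eps]. *)
have eps'0 : 0 < c * eps by rewrite mulr_gt0.
have [h' Hh' B] := Bm h Hh _ eps'0.
exists h' => //.
have := B _ (trace_space_diff sigmaS tauS c1 le_c).
have := B _ tauS.
rewrite !sigma0// !sub0r.
have -> : (1 - c)^-1 * - (c * tau h) - m%:R * ((1 - c)^-1 * - (c * tau h')) =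
    - (c / (1 - c) * (tau h - m%:R * tau h')) by ring.
have c1' : 0 < 1 - c by lra.
rewrite lerN2 => lo; rewrite -mulrA ler_pM2l// ler_pdivrMl// => up.
rewrite ler_norml; apply/andP; split; nra.
Qed.

Lemma dense_of_small (R : realType) (A : set R) :
  (forall (a : R) (n : int), A a -> A (a *~ n)) ->
  (forall eps : R, 0 < eps -> exists2 a, A a & 0 < `|a| < eps) -> dense A.
Proof.
move=> AZ small U [x Ux] oU.
have /nbhs_ballP[e /= e0 xeU] : nbhs x U by exact: open_nbhs_nbhs.
have [a Aa /andP[a0 ae]] := small e e0.
have ann : a != 0 by rewrite -normr_gt0.
(* The distance to [x] is the fractional part of [x / a] times [|a|]. *)
exists (a *~ Num.floor (x / a)); split; last exact: AZ.
apply: xeU; rewrite /ball/=.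
have -> : x - a *~ Num.floor (x / a) = (x / a - (Num.floor (x / a))%:~R) * a.
  by rewrite mulrBl divfK// mulrzl.
rewrite normrM; apply: le_lt_trans ae.
have /andP[lo up] := floor_itv (x / a).
rewrite ler_piMl// ger0_norm ?subr_ge0// lerBlDl ltW//.
by rewrite intrD in up.
Qed.

Lemma small_of_contraction (R : realType) (A : set R) :
  (exists2 a, A a & a != 0) ->
  (forall a, A a -> a != 0 -> exists2 b, A b & 0 < `|b| <= 3 / 4 * `|a|) ->
  forall eps : R, 0 < eps -> exists2 a, A a & 0 < `|a| < eps.
Proof.
move=> [a0 Aa0 a0n] contr.
pose N := [set `|a| | a in A `&` [set a | a != 0]].
have N0 : N `|a0| by exists a0.
have lbN : lbound N 0 by move=> _ [b _ <-].
have hN : has_inf N by split; [exists `|a0| | exists 0].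
have infN : inf N <= 0.
  rewrite leNgt; apply/negP => i0.
  (* Some [|a|] is below 5/4 of the infimum, and contracting by 3/4 gives at most 15/16 of it. *)
  have [_ [a [Aa an] <-] alt] := inf_adherent (divr_gt0 i0 (ltr0n _ 4)) hN.
  have [b Ab /andP[b0 ba]] := contr a Aa an.
  have : inf N <= `|b|.
    apply: ge_inf; [by case: hN | exists b => //; split=> //].
    by rewrite /= -normr_gt0.
  lra.
move=> eps eps0.
have [_ [a [Aa an] <-] alt] := inf_adherent eps0 hN.
exists a => //; rewrite normr_gt0 an /=; lra.
Qed.

Theorem theorem3p1 (R : realType) (G : porderZmodType) (u : G)
    (H : zmodClosed G) :
  translation_invariant G ->
  order_unit u ->
  property_B R u H ->
  forall tau : G -> R,
    smallest (face (trace_space u)) (vanishing_traces u H) tau ->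
    tau @` [set` H] = [set 0] \/ dense (tau @` [set` H]).
Proof.
move=> _ [_ u_ge0 _] [m m1 Bm] tau tauF.
have tauD : dominated_traces u (vanishing_traces u H) tau.
  apply: tauF; split; first exact: dominated_traces_face.
  by apply: subset_dominated_traces => sigma [].
have [[[tauB _ _] _] _] := tauD.
pose tauA := GRing.isZmodMorphism.Build G R tau tauB.
pose f : {additive G -> R} := HB.pack tau tauA.
have [tau0|/existsNP[h0 /not_implyP[Hh0 /eqP th0]]] :=
    pselect (forall h, h \in H -> tau h = 0).
  left; apply/seteqP; split=> [_ [h Hh <-]|_ ->]; first exact: tau0.
  by exists 0; [exact: rpred0 | exact: (raddf0 f)].
right; apply: dense_of_small => [_ n [h Hh <-]|].
  by exists (h *~ n); [exact: rpredMz | exact: (raddfMz f)].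
apply: small_of_contraction => [|_ [h Hh <-] th].
  by exists (tau h0) => //; exists h0.
(* Tolerance [|tau h| / 2] puts [m |tau h'|] between 1/2 and 3/2 of [|tau h|]: hence [tau h'] is
   nonzero, and [m >= 2] yields the factor 3/4. *)
have th_gt0 : 0 < `|tau h| by rewrite normr_gt0.
have [h' Hh' le_h'] :=
  dominated_trace_approx u_ge0 Bm tauD Hh (divr_gt0 th_gt0 (ltr0n _ 2)).
exists (tau h'); first by exists h'.
have m2 : (2 : R) <= m%:R by rewrite ler_nat.
have nm : `|m%:R * tau h'| = m%:R * `|tau h'| by rewrite normrM normr_nat.
have := ler_normB (tau h) (tau h - m%:R * tau h').
have := lerB_dist (tau h) (m%:R * tau h').
rewrite subKr nm => lo up.
have h'0 : 0 <= `|tau h'| := normr_ge0 _.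
apply/andP; split; last by nra.
rewrite lt0r h'0 andbT; apply/eqP => h'E; move: lo; rewrite h'E mulr0; lra.
Qed.
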